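(* The following are equivalent for a $T_0$ space $X$. \begin{enumerate} \item The space $X$ is $T_1$. \item The Raney extension $(\Omega(X),\mathcal{U}(X))$ is $(\Omega(X),\mathcal{P}(X))$. \item The Raney extension $(\Omega(X),\mathcal{U}(X))$ is $\mathcal{R}$-dense. \item The Raney extension $(\Omega(X),\mathcal{U}(X))$ is $\mathcal{R}$-canonical. \item The Raney extension $(\Omega(X),\mathcal{U}(X))$ is isomorphic to $(\Omega(X),\mathsf{Filt}_{\mathcal{R}}(\Omega(X))^{op})$. \end{enumerate}
   Context: $\Omega(X)$ is the frame of opens of $X$, $\mathcal{U}(X)$ the lattice of saturated sets (intersections of open sets), $\mathcal{P}(X)$ the powerset. A Raney extension is a pair $(L,C)$ where $C$ is a coframe, $L\subseteq C$ is a frame such that every element of $C$ is a meet of elements of $L$, and the inclusion preserves arbitrary joins, finite meets, and strongly exact meets of $L$ (a meet $\bigwedge_i x_i$ in $L$ is strongly exact if for all $y\in L$, $x_i\to y=y$ for all $i$ implies $(\bigwedge_i x_i)\to y=y$). A morphism $f:(L,C)\to(M,D)$ is a coframe map $f:C\to D$ (preserving arbitrary meets and finite joins) with $f[L]\subseteq M$ restricting to a frame map $L\to M$; isomorphisms are taken in this category. $\mathsf{Filt}(L)$ is the frame of all filters of $L$ (including the improper one) ordered by inclusion. A filter is regular if it is a regular element of $\mathsf{Filt}(L)$, i.e. of the form $F\to\{1\}$ for some filter $F$, with $\to$ the Heyting implication of $\mathsf{Filt}(L)$; equivalently, it is an intersection of filters of the form $\{x\in L:x\vee a=1\}$, $a\in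 L$. $\mathsf{Filt}_{\mathcal{R}}(L)$ is the collection of regular filters ordered by inclusion. In the pair $(L,\mathsf{Filt}_{\mathcal{R}}(L)^{op})$, $a\in L$ is identified with the principal filter $\uparrow a$; item (5) includes the assertion that this pair (for $L=\Omega(X)$) is a Raney extension. A Raney extension $(L,C)$ is $\mathcal{R}$-dense if each element of $C$ is a join of elements $\bigwedge F$ (meet in $C$) with $F$ a regular filter of $L$; $\mathcal{R}$-compact if for every regular filter $F$ and $a\in L$, $\bigwedge F\le a$ implies $a\in F$; $\mathcal{R}$-canonical if it is both. *)

(* Defs.v *)
From mathcomp Require Import all_boot all_order.
From mathcomp Require Import all_classical.
From mathcomp Require Import topology.

Set Implicit Arguments.
Unset Strict Implicit.
Unset Printing Implicit Defensive.

Local Open Scope classical_set_scope.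

(* Posets are given as subsets S of an ambient porderType, with the induced
   order, so that a Raney extension (L, C) is literally a pair of subsets with
   L `<=` C. Joins, meets and implications are relations taken inside S: a
   subset of S may have different joins in S and in the ambient type. *)
Section SubPosets.
Context {d : Order.disp_t} {T : porderType d}.
Implicit Types (S L C A : set T) (a b m x y : T).

Definition is_join S A x : Prop :=
  (S `&` ubound A) x /\ lbound (S `&` ubound A) x.

Definition is_meet S A x : Prop :=
  (S `&` lbound A) x /\ ubound (S `&` lbound A) x.

Definition complete_lattice S : Prop := forall A, A `<=` S ->
  (exists x, is_join S A x) /\ (exists x, is_meet S A x).

(* a /\ \/A = \/_(b in A) (a /\ b) *)
Definition is_frame S : Prop := complete_lattice S /\
  forall a A x y, S a -> A `<=` S -> is_join S A x -> is_meet S [set a; x] y ->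
    is_join S [set z | exists2 b, A b & is_meet S [set a; b] z] y.

(* a \/ /\A = /\_(b in A) (a \/ b) *)
Definition is_coframe S : Prop := complete_lattice S /\
  forall a A x y, S a -> A `<=` S -> is_meet S A x -> is_join S [set a; x] y ->
    is_meet S [set z | exists2 b, A b & is_join S [set a; b] z] y.

(* c = a -> b in S, i.e. x <= c iff x /\ a <= b *)
Definition is_imp S a b c : Prop := [/\ S a, S b, S c &
  forall x, S x -> ((x <= c)%O <-> exists2 m, is_meet S [set x; a] m & (m <= b)%O)].

Definition strongly_exact L A m : Prop := [/\ A `<=` L, is_meet L A m &
  forall y, L y -> (forall x, A x -> is_imp L x y y) -> is_imp L m y y].

Definition top_set L : set T := [set t | is_meet L set0 t].

End SubPosets.

Section Filters.
Context {d : Order.disp_t} {T : porderType d}.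
Implicit Types (L F : set T) (a m x y : T).

Definition filters L : set (set T) := [set F | [/\ F `<=` L,
  top_set L `<=` F,
  forall x y, F x -> L y -> (x <= y)%O -> F y &
  forall x y m, F x -> F y -> is_meet L [set x; y] m -> F m]].

(* The order of set T is inclusion; top_set L is the singleton filter {1}. *)
Definition regular_filters L : set (set T) :=
  [set R | exists2 F, filters L F & is_imp (filters L) F (top_set L) R].

Definition up_filter L a : set T := [set x | L x /\ (a <= x)%O].

End Filters.

(* A pair E consists of L = E.1 and C = E.2. *)
Record is_raney {d} {T : porderType d} (E : set T * set T) : Prop := IsRaney {
  raney_coframe : is_coframe E.2;
  raney_sub : E.1 `<=` E.2;
  raney_frame : is_frame E.1;
  raney_generate : forall c, E.2 c ->
    exists2 A, A `<=` E.1 & is_meet E.2 A c;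
  raney_joins : forall A x, A `<=` E.1 ->
    is_join E.1 A x -> is_join E.2 A x;
  raney_finite_meets : forall A x, A `<=` E.1 -> finite_set A ->
    is_meet E.1 A x -> is_meet E.2 A x;
  raney_strongly_exact : forall A x,
    strongly_exact E.1 A x -> is_meet E.2 A x }.

(* A map between sub-posets is represented by a function on the ambient types;
   only its values on the domain sub-poset are relevant. *)
Section Morphisms.
Context {d d' : Order.disp_t} {T : porderType d} {T' : porderType d'}.

Definition frame_map (L : set T) (M : set T') (f : T -> T') : Prop :=
  [/\ set_fun L M f,
      forall A x, A `<=` L -> is_join L A x -> is_join M (f @` A) (f x) &
      forall A x, A `<=` L -> finite_set A ->
        is_meet L A x -> is_meet M (f @` A) (f x)].

Definition coframe_map (C : set T) (D : set T') (f : T -> T') : Prop :=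
  [/\ set_fun C D f,
      forall A x, A `<=` C -> is_meet C A x -> is_meet D (f @` A) (f x) &
      forall A x, A `<=` C -> finite_set A ->
        is_join C A x -> is_join D (f @` A) (f x)].

Definition raney_morphism (E : set T * set T) (E' : set T' * set T')
    (f : T -> T') : Prop :=
  coframe_map E.2 E'.2 f /\ frame_map E.1 E'.1 f.

End Morphisms.

Definition raney_isomorphic {d d'} {T : porderType d} {T' : porderType d'}
    (E : set T * set T) (E' : set T' * set T') : Prop :=
  exists (f : T -> T') (g : T' -> T),
    [/\ raney_morphism E E' f, raney_morphism E' E g,
        (forall x, E.2 x -> g (f x) = x) & (forall y, E'.2 y -> f (g y) = y)].

Section Regularity.
Context {d : Order.disp_t} {T : porderType d}.
Implicit Type E : set T * set T.

Definition R_dense E : Prop := forall c, E.2 c ->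
  exists2 A : set T,
    A `<=` [set m | exists2 F, regular_filters E.1 F & is_meet E.2 F m] &
    is_join E.2 A c.

Definition R_compact E : Prop := forall F a m,
  regular_filters E.1 F -> E.1 a -> is_meet E.2 F m -> (m <= a)%O -> F a.

Definition R_canonical E : Prop := R_dense E /\ R_compact E.

(* (L, Filt_R(L)^op), living in (set T)^d, i.e. set T ordered by reverse
   inclusion; L is embedded as its set of principal filters. *)
Definition regular_filter_pair (L : set T) :
    set ((set T)^d)%type * set ((set T)^d)%type :=
  (up_filter L @` L, regular_filters L).

End Regularity.

Section Spaces.
Context (X : topologicalType).

Definition opens : set (set X) := [set U | open U].

Definition saturated : set (set X) :=
  [set S | exists2 G : set (set X), G `<=` opens & S = \bigcap_(U in G) U].

Definition opens_saturated : set (set X) * set (set X) := (opens, saturated).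

Definition opens_powerset : set (set X) * set (set X) := (opens, setT).

End Spaces.

Arguments opens : clear implicits.
Arguments saturated : clear implicits.

(* Main.v *)
Require Import Defs.
From mathcomp Require Import all_boot all_order.
From mathcomp Require Import all_classical.
From mathcomp Require Import topology.

(** Regular filters of opens are polars. For a family A of opens let polar A be
the filter of the opens U with U `|` V = setT for all V in A; since
G `&` F = {1} says that every member of G joins every member of F to the top,
F -> {1} is polar F, and polarity being a Galois connection, the regular filters
are exactly the polars (regular_filtersP). Two consequences drive the proof.

First, a polar is determined by its intersection: if \bigcap (polar A) `<=` U
then U is in polar A, because a point x outside some V in A lies in every member
of polar A. So (opens, saturated) is always R-compact, and R-canonicity is just
R-density.

Second, in a T0 space, if for each point y some regular filter has the
saturation of y as its intersection, then the space is T1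
(accessible_of_regular_point_filters). R-density provides such filters: the
saturation of y is completely join-prime among saturated sets, so it must itself
be one of the meets of regular filters of which it is a join. An isomorphism
with the pair of regular filters provides them as well: it restricts to an
order automorphism psi of the frame of opens, it sends the saturation of y to
some polar A, and the open neighborhoods of y are then polar (psi @` A).

Conversely, in a T1 space every set S is saturated, and the opens above S form
the polar of the sets ~` [set x] for x in S. This gives R-density, singletons
being meets of regular filters, and makes S |-> up_filter S an order isomorphism
from the powerset onto the regular filters ordered by reverse inclusion, with
inverse the intersection. Since being a Raney extension is invariant under
order isomorphism (iso_raney), the regular filters inherit this structure
from the saturated sets (opens_saturated_raney). *)

Set Implicit Arguments.
Unset Strict Implicit.
Unset Printing Implicit Defensive.

Import Order.TTheory.

Local Open Scope classical_set_scope.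

(** * Sub-posets *)

Section Uniqueness.
Context {d : Order.disp_t} {T : porderType d}.
Implicit Types (S A : set T) (a b c x y : T).

Lemma is_join_unique S A x y : is_join S A x -> is_join S A y -> x = y.
Proof.
move=> [Ax minx] [Ay miny].
by apply/le_anti/andP; split; [exact: minx|exact: miny].
Qed.

Lemma is_meet_unique S A x y : is_meet S A x -> is_meet S A y -> x = y.
Proof.
move=> [Ax maxx] [Ay maxy].
by apply/le_anti/andP; split; [exact: maxy|exact: maxx].
Qed.

Lemma is_imp_unique S a b c c' : is_imp S a b c -> is_imp S a b c' -> c = c'.
Proof.
move=> [_ _ Sc cP] [_ _ Sc' c'P]; apply/le_anti/andP; split.
- by apply/(c'P _ Sc)/(cP _ Sc).
- by apply/(cP _ Sc')/(c'P _ Sc').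
Qed.

Lemma is_meet_pair_le S x y : S x -> (x <= y)%O -> is_meet S [set x; y] x.
Proof.
move=> Sx xy; split; first by split=> // _ [->|->].
by move=> z [_ zl]; apply: zl; left.
Qed.

End Uniqueness.

(** Mutually inverse order isomorphisms between sub-posets. All the notions
of a Raney extension are order-theoretic, hence transported by them; a pair of
inverse morphisms of Raney extensions is one (raney_isomorphic_order_iso). *)
Record order_iso {d d'} {T : porderType d} {T' : porderType d'}
    (S : set T) (S' : set T') (f : T -> T') (g : T' -> T) : Prop := OrderIso {
  iso_fun : set_fun S S' f;
  iso_inv_fun : set_fun S' S g;
  isoK : forall x, S x -> g (f x) = x;
  iso_invK : forall y, S' y -> f (g y) = y;
  iso_le : forall x y, S x -> S y -> (f x <= f y)%O = (x <= y)%O }.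

Lemma order_iso_sym {d d'} {T : porderType d} {T' : porderType d'}
    (S : set T) (S' : set T') f g :
  order_iso S S' f g -> order_iso S' S g f.
Proof.
move=> [fS gS fK gK fle]; split=> // x y Sx Sy.
by rewrite -fle ?gK //; exact: gS.
Qed.

Section OrderIso.
Context {d d' : Order.disp_t} {T : porderType d} {T' : porderType d'}.
Variables (S : set T) (S' : set T') (f : T -> T') (g : T' -> T).
Hypothesis fg : order_iso S S' f g.

Lemma iso_image_sub A : A `<=` S -> f @` A `<=` S'.
Proof. by move=> AS _ [x /AS Sx <-]; exact: iso_fun fg _ Sx. Qed.

Lemma iso_image_invK A : A `<=` S' -> f @` (g @` A) = A.
Proof.
move=> AS; apply/seteqP; split=> [_ [_ [y Ay <-] <-]|y Ay].
  by rewrite (iso_invK fg) //; exact: AS.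
by exists (g y); [exists y|rewrite (iso_invK fg) //; exact: AS].
Qed.

Lemma iso_sub L : L `<=` S -> order_iso L (f @` L) f g.
Proof.
move=> LS; split.
- by move=> x Lx; exists x.
- by move=> _ [x Lx <-]; rewrite /= (isoK fg) //; exact: LS.
- by move=> x /LS; exact: isoK fg _.
- by move=> _ [x /LS Sx <-]; rewrite (isoK fg).
- by move=> x y /LS Sx /LS Sy; exact: iso_le fg _ _ Sx Sy.
Qed.

Lemma iso_join A x : A `<=` S -> is_join S A x -> is_join S' (f @` A) (f x).
Proof.
move=> AS [[Sx ubx] minx]; split.
  split; first exact: iso_fun fg _ Sx.
  by move=> _ [y Ay <-]; rewrite (iso_le fg) ?ubx //; exact: AS.
move=> y [S'y uby]; rewrite -(iso_invK fg S'y) (iso_le fg) //; last first.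
  exact: iso_inv_fun fg _ S'y.
apply: minx; split; first exact: iso_inv_fun fg _ S'y.
move=> z Az; rewrite -(iso_le fg) ?(iso_invK fg) //; first by apply: uby; exists z.
- exact: AS.
- exact: iso_inv_fun fg _ S'y.
Qed.

End OrderIso.

(** Reversing both orders turns each statement on joins and frames into the
one on meets and coframes, by conversion. *)
Lemma order_iso_dual {d d'} {T : porderType d} {T' : porderType d'}
    (S : set T) (S' : set T') f g : order_iso S S' f g ->
  @order_iso _ _ T^d T'^d S S' f g.
Proof.
by move=> [fS gS fK gK fle]; split=> // x y Sx Sy; exact: fle.
Qed.

Lemma iso_meet {d d'} {T : porderType d} {T' : porderType d'}
    (S : set T) (S' : set T') f g A x : order_iso S S' f g ->
  A `<=` S -> is_meet S A x -> is_meet S' (f @` A) (f x).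
Proof. by move=> /order_iso_dual fg; exact: (iso_join fg). Qed.

Lemma pair_sub {U} (S : set U) a b : S a -> S b -> [set a; b] `<=` S.
Proof. by move=> Sa Sb _ [->|->]. Qed.

Lemma iso_meet2 {d d'} {T : porderType d} {T' : porderType d'}
    (S : set T) (S' : set T') f g a b x : order_iso S S' f g -> S a -> S b ->
  is_meet S [set a; b] x -> is_meet S' [set f a; f b] (f x).
Proof.
move=> fg Sa Sb /(iso_meet fg (pair_sub Sa Sb)).
by rewrite image_setU !image_set1.
Qed.

Lemma iso_imp {d d'} {T : porderType d} {T' : porderType d'}
    (S : set T) (S' : set T') f g a b c : order_iso S S' f g ->
  is_imp S a b c -> is_imp S' (f a) (f b) (f c).
Proof.
move=> fg [Sa Sb Sc cP]; have fS := iso_fun fg; have gS := iso_inv_fun fg.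
split; [exact: fS|exact: fS|exact: fS|move=> y S'y].
have Sgy := gS _ S'y.
rewrite -{1}(iso_invK fg S'y) (iso_le fg) // cP //; split=> -[m mm mb].
- exists (f m); last by rewrite (iso_le fg) //; case: mm => -[].
  by rewrite -(iso_invK fg S'y); exact: iso_meet2 fg Sgy Sa mm.
- have S'm : S' m by case: mm => -[].
  exists (g m); last by rewrite -(iso_le fg) ?(iso_invK fg) //; exact: gS.
  rewrite -{1}(isoK fg Sa).
  exact: iso_meet2 (order_iso_sym fg) S'y (fS _ Sa) mm.
Qed.

Section RaneyTransport.
Context {d d' : Order.disp_t} {T : porderType d} {T' : porderType d'}.
Variables (f : T -> T') (g : T' -> T).

Lemma iso_complete (S : set T) (S' : set T') : order_iso S S' f g ->
  complete_lattice S -> complete_lattice S'.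
Proof.
move=> fg cS A AS; have gAS := iso_image_sub (order_iso_sym fg) AS.
have [[x xj] [y ym]] := cS _ gAS; rewrite -(iso_image_invK fg AS); split.
- by exists (f x); exact: (iso_join fg).
- by exists (f y); exact: (iso_meet fg).
Qed.

Lemma iso_frame (S : set T) (S' : set T') :
  order_iso S S' f g -> is_frame S -> is_frame S'.
Proof.
move=> fg [cS fS]; split; first exact: iso_complete cS.
have gf := order_iso_sym fg.
move=> a A x y S'a AS xj ym.
have Sx : S' x by case: xj => -[].
have Sy : S' y by case: ym => -[].
have gAS := iso_image_sub gf AS.
have ga : S (g a) by exact: iso_fun gf _ _.
have := fS _ _ _ (g y) ga gAS (iso_join gf AS xj).
move=> /(_ (iso_meet2 gf S'a Sx ym)) /(iso_join fg).
rewrite (iso_invK fg Sy); set B := (X in X `<=` _).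
have BS : B `<=` S by move=> z [b _ [[]]].
move=> /(_ BS); congr is_join; apply/seteqP; split=> z.
- case=> w [_ [b Ab <-]] wm <-; exists b => //; have S'b := AS _ Ab.
  rewrite -(iso_invK fg S'a) -(iso_invK fg S'b).
  by apply: (iso_meet2 fg) wm => //; exact: iso_fun gf _ S'b.
- case=> b Ab zm; have S'z : S' z by case: zm => -[].
  exists (g z); last by rewrite (iso_invK fg).
  exists (g b); first by exists b.
  exact: iso_meet2 gf S'a (AS _ Ab) zm.
Qed.

End RaneyTransport.

Lemma iso_coframe {d d'} {T : porderType d} {T' : porderType d'}
    (S : set T) (S' : set T') f g :
  order_iso S S' f g -> is_coframe S -> is_coframe S'.
Proof.
move=> /order_iso_dual fg [cS fS].
have dual d0 (T0 : porderType d0) (S0 : set T0) :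
    complete_lattice S0 -> @complete_lattice _ T0^d S0.
  by move=> cS0 A /cS0 [j m].
have [cS' fS'] : @is_frame _ T'^d S'.
  by apply: (iso_frame fg); split; [exact: dual|exact: fS].
by split; [exact: dual cS'|exact: fS'].
Qed.

Section RaneyIso.
Context {d d' : Order.disp_t} {T : porderType d} {T' : porderType d'}.

Lemma iso_coframe_map (S : set T) (S' : set T') f g :
  order_iso S S' f g -> coframe_map S S' f.
Proof.
move=> fg; split; first exact: iso_fun fg.
- by move=> A x; exact: (iso_meet fg).
- by move=> A x AS _; exact: (iso_join fg).
Qed.

Lemma iso_frame_map (S : set T) (S' : set T') f g :
  order_iso S S' f g -> frame_map S S' f.
Proof.
move=> fg; split; first exact: iso_fun fg.
- by move=> A x; exact: (iso_join fg).
- by move=> A x AS _; exact: (iso_meet fg).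
Qed.

End RaneyIso.

Section RaneyAlongIso.
Context {d d' : Order.disp_t} {T : porderType d} {T' : porderType d'}.
Variables (E : set T * set T) (D : set T') (f : T -> T') (g : T' -> T).
Hypotheses (fg : order_iso E.2 D f g) (LC : E.1 `<=` E.2).

Lemma iso_raney_isomorphic : raney_isomorphic E (f @` E.1, D).
Proof.
have fgL := iso_sub fg LC.
exists f, g; split.
- by split; [exact: iso_coframe_map fg|exact: iso_frame_map fgL].
- split; [exact: iso_coframe_map (order_iso_sym fg)|].
  exact: iso_frame_map (order_iso_sym fgL).
- exact: isoK fg.
- exact: iso_invK fg.
Qed.

(** Each clause is pulled back along g, applied in E, and pushed forward
along f. *)
Lemma iso_raney : is_raney E -> is_raney (f @` E.1, D).
Proof.
move=> [cofr _ fr gen joins meets exact_meets].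
have fgL := iso_sub fg LC; have gf := order_iso_sym fg.
have gfL := order_iso_sym fgL.
have LD : f @` E.1 `<=` D by exact: (iso_image_sub fg).
have fgx A x : A `<=` f @` E.1 -> is_meet E.2 (g @` A) (g x) -> D x ->
    is_meet D A x.
  move=> AL /(iso_meet fg) xm Dx.
  rewrite -(iso_invK fg Dx) -(iso_image_invK fgL AL); apply: xm.
  exact: subset_trans (iso_image_sub gfL AL) LC.
split=> /=.
- exact: (iso_coframe fg).
- exact: LD.
- exact: (iso_frame fgL).
- move=> c Dc; have [A AL /(iso_meet fg) cm] := gen _ (iso_fun gf Dc).
  exists (f @` A); first exact: (iso_image_sub fgL).
  by rewrite -(iso_invK fg Dc); apply: cm; exact: subset_trans AL LC.
- move=> A x AL xj.
  have Dx : D x by apply: LD; case: xj => -[].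
  rewrite -(iso_invK fg Dx) -(iso_image_invK fgL AL); apply: (iso_join fg).
    exact: subset_trans (iso_image_sub gfL AL) LC.
  by apply: joins; [exact: (iso_image_sub gfL)|exact: (iso_join gfL)].
- move=> A x AL fA xm; apply: fgx => //; last by apply: LD; case: xm => -[].
  apply: meets; [exact: (iso_image_sub gfL)|exact: finite_image|].
  exact: (iso_meet gfL).
- move=> A x [AL xm sx]; apply: fgx => //; last by apply: LD; case: xm => -[].
  apply: exact_meets; split.
  + exact: (iso_image_sub gfL).
  + exact: (iso_meet gfL).
  + move=> y Ly Ay.
    rewrite -(isoK fgL Ly); apply: (iso_imp gfL); apply: sx.
      exact: iso_fun fgL _ Ly.
    move=> z Az; rewrite -(iso_invK fgL (AL _ Az)).
    by apply: (iso_imp fgL); apply: Ay; exists z.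
Qed.

End RaneyAlongIso.

(** A map preserving binary meets is monotone, as x <= y says that x is the
meet of x and y; applied to f and to g, this makes f an order isomorphism. *)
Lemma raney_isomorphic_order_iso {d d'} {T : porderType d} {T' : porderType d'}
    (E : set T * set T) (E' : set T' * set T') :
  raney_isomorphic E E' -> exists f g,
    [/\ order_iso E.2 E'.2 f g, set_fun E.1 E'.1 f & set_fun E'.1 E.1 g].
Proof.
move=> [f [g [[[fC fm _] [fL _ _]] [[gC gm _] [gL _ _]] fK gK]]].
exists f, g; split=> //; split=> // x y Cx Cy.
have mono d1 d2 (T1 : porderType d1) (T2 : porderType d2) (C : set T1)
    (D : set T2) (h : T1 -> T2) u v :
    (forall A z, A `<=` C -> is_meet C A z -> is_meet D (h @` A) (h z)) ->
    C u -> C v -> (u <= v)%O -> (h u <= h v)%O.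
  move=> hm Cu Cv uv.
  have [[_ +] _] := hm _ _ (pair_sub Cu Cv) (is_meet_pair_le Cu uv).
  by apply; exists v => //; right.
apply/idP/idP; last exact: mono fm Cx Cy.
by move=> /(mono _ _ _ _ _ _ _ _ _ gm (fC _ Cx) (fC _ Cy)); rewrite !fK.
Qed.

(** * Families of sets *)

Section SetFamilies.
Context {Y : Type}.
Implicit Types (S A : set (set Y)) (a b x : set Y).

(** When a family of sets contains the union (or intersection) of A, this is
the join (or meet) of A inside the family. An infinite meet of opens among opens
escapes this: it is the interior of the intersection. *)
Lemma is_joinE S A x : S (\bigcup_(B in A) B) ->
  is_join S A x <-> x = \bigcup_(B in A) B.
Proof.
move=> SA.
have joinA : is_join S A (\bigcup_(B in A) B).
  split; first by split=> // B AB; rewrite subsetEset; exact: bigcup_sup.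
  move=> z [_ ubz]; rewrite subsetEset; apply: bigcup_sub => B /ubz.
  by rewrite subsetEset.
by split=> [xj|->//]; exact: is_join_unique xj joinA.
Qed.

Lemma is_meetE S A x : S (\bigcap_(B in A) B) ->
  is_meet S A x <-> x = \bigcap_(B in A) B.
Proof.
move=> SA.
have meetA : is_meet S A (\bigcap_(B in A) B).
  split; first by split=> // B AB; rewrite subsetEset; exact: bigcap_inf.
  move=> z [_ lbz]; rewrite subsetEset; apply: sub_bigcap => B /lbz.
  by rewrite subsetEset.
by split=> [xm|->//]; exact: is_meet_unique xm meetA.
Qed.

Lemma is_join2E S a b x : S (a `|` b) -> is_join S [set a; b] x <-> x = a `|` b.
Proof.
have <- : \bigcup_(B in [set a; b]) B = a `|` b.
  by rewrite bigcup_setU1 bigcup_set1.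
exact: is_joinE.
Qed.

Lemma is_meet2E S a b x : S (a `&` b) -> is_meet S [set a; b] x <-> x = a `&` b.
Proof.
have <- : \bigcap_(B in [set a; b]) B = a `&` b.
  by rewrite bigcap_setU1 bigcap_set1.
exact: is_meetE.
Qed.

Lemma set_family_frame S :
    (forall A, A `<=` S -> S (\bigcup_(B in A) B)) ->
    (forall a b, S a -> S b -> S (a `&` b)) ->
  is_frame S.
Proof.
move=> SU SI; split=> [A AS|a A x y Sa AS].
  split; first by exists (\bigcup_(B in A) B); apply/is_joinE => //; exact: SU.
  (* S need not contain the intersection of A; the meet is the union of all
     the lower bounds of A in S. *)
  have SM : S (\bigcup_(B in S `&` lbound A) B) by apply: SU => B [].
  exists (\bigcup_(B in S `&` lbound A) B); split.
    split=> // C AC; rewrite subsetEset; apply: bigcup_sub => B [_ /(_ _ AC)].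
    by rewrite subsetEset.
  by move=> B lB; rewrite subsetEset; exact: bigcup_sup.
move=> /(is_joinE _ (SU _ AS)) xE.
have Sx : S x by rewrite xE; exact: SU.
move=> /(is_meet2E _ (SI _ _ Sa Sx)) ->; rewrite xE setI_bigcupr.
have -> : [set z | exists2 b, A b & is_meet S [set a; b] z] = setI a @` A.
  apply/seteqP; split=> z [b Ab].
    by move=> /(is_meet2E _ (SI _ _ Sa (AS _ Ab))) ->; exists b.
  by move=> <-; exists b => //; apply/is_meet2E => //; exact: SI (AS _ Ab).
apply/is_joinE; rewrite bigcup_image // -setI_bigcupr.
by apply: SI => //; exact: SU.
Qed.

Lemma set_family_coframe S :
    (forall A, A `<=` S -> S (\bigcap_(B in A) B)) ->
    (forall a b, S a -> S b -> S (a `|` b)) ->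
  is_coframe S.
Proof.
move=> SI SU; split=> [A AS|a A x y Sa AS].
  split; last by exists (\bigcap_(B in A) B); apply/is_meetE => //; exact: SI.
  have SM : S (\bigcap_(B in S `&` ubound A) B) by apply: SI => B [].
  exists (\bigcap_(B in S `&` ubound A) B); split.
    split=> // C AC; rewrite subsetEset; apply: sub_bigcap => B [_ /(_ _ AC)].
    by rewrite subsetEset.
  by move=> B lB; rewrite subsetEset; exact: bigcap_inf.
move=> /(is_meetE _ (SI _ AS)) xE.
have Sx : S x by rewrite xE; exact: SI.
move=> /(is_join2E _ (SU _ _ Sa Sx)) ->; rewrite xE setU_bigcapr.
have -> : [set z | exists2 b, A b & is_join S [set a; b] z] = setU a @` A.
  apply/seteqP; split=> z [b Ab].
    by move=> /(is_join2E _ (SU _ _ Sa (AS _ Ab))) ->; exists b.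
  by move=> <-; exists b => //; apply/is_join2E => //; exact: SU (AS _ Ab).
apply/is_meetE; rewrite bigcap_image // -setU_bigcapr.
by apply: SU => //; exact: SI.
Qed.

End SetFamilies.

(** * Opens and saturated sets *)

Section Saturated.
Context {X : topologicalType}.
Implicit Types (x y z : X) (U V W S : set X).

Definition specializes x y : Prop := forall U, open U -> U x -> U y.

Lemma closure_set1P x z : closure [set x] z <-> specializes z x.
Proof.
split=> [clz U oU Uz|zx B].
  by have [_ [-> //]] := clz U (open_nbhs_nbhs (conj oU Uz)).
by rewrite nbhsE => -[U [oU Uz] UB]; exists x; split=> //; exact: UB (zx _ oU Uz).
Qed.

Lemma specializes_anti x y : kolmogorov_space X ->
  specializes x y -> specializes y x -> x = y.
Proof.
move=> T0 xy yx; apply/eqP/negPn/negP => /T0 [A].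
rewrite !inE !nbhsE /= => -[|] [[U [oU Ux] UA]]; apply; apply: UA.
- exact: xy.
- exact: yx.
Qed.

Lemma accessible_spaceP :
  accessible_space X <-> (forall x y, specializes x y -> x = y).
Proof.
split=> [T1 x y xy|T1 x y /eqP xy].
  apply/eqP/negPn/negP => /T1 [U [oU]]; rewrite !inE => Ux; apply.
  exact: xy.
apply: contrapT => nU; apply/xy/T1 => U oU Ux; apply: contrapT => Uy.
by apply: nU; exists U; rewrite !inE.
Qed.

(** Saturated sets are the up-closed sets of the specialization preorder; this
form makes their closure under unions and intersections evident. *)
Lemma saturatedP S :
  saturated X S <-> (forall x y, S x -> specializes x y -> S y).
Proof.
split=> [[G Go ->] x y xS xy U GU|up].
  by apply: xy; [exact: Go|exact: xS].
exists [set U | open U /\ S `<=` U]; first by move=> U [].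
apply/seteqP; split=> [x Sx U [_ +]|y yS]; first exact.
apply: contrapT => Sy.
(* The opens avoiding y cover S. *)
have [U [_ Uy] //] : (\bigcup_(U in [set U | open U /\ ~ U y]) U) y.
apply: yS; split; first by apply: bigcup_open => U [].
move=> x Sx; apply: contrapT => xU; apply/Sy/(up _ _ Sx) => U oU Ux.
by apply: contrapT => Uy; apply: xU; exists U.
Qed.

Lemma saturated_bigcup (A : set (set X)) :
  A `<=` saturated X -> saturated X (\bigcup_(B in A) B).
Proof.
move=> AS; apply/saturatedP => x y [B AB Bx] xy; exists B => //.
by have /saturatedP := AS _ AB; apply; [exact: Bx|].
Qed.

Lemma saturated_bigcap (A : set (set X)) :
  A `<=` saturated X -> saturated X (\bigcap_(B in A) B).
Proof.
move=> AS; apply/saturatedP => x y Ax xy B AB.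
by have /saturatedP := AS _ AB; apply; [exact: Ax|].
Qed.

Lemma open_saturated U : open U -> saturated X U.
Proof. by move=> oU; apply/saturatedP => x y Ux; exact. Qed.

Lemma opens_saturated_sub : opens X `<=` saturated X.
Proof. by move=> U; exact: open_saturated. Qed.

Lemma saturated_meetE (A : set (set X)) m : A `<=` opens X ->
  is_meet (saturated X) A m <-> m = \bigcap_(U in A) U.
Proof.
move=> Ao; apply: is_meetE; apply: saturated_bigcap.
by move=> U /Ao; exact: open_saturated.
Qed.

Lemma open_finite_bigcap (A : set (set X)) :
  finite_set A -> A `<=` opens X -> open (\bigcap_(U in A) U).
Proof.
move=> /finite_seqP[s ->] so; rewrite bigcap_seq.
rewrite big_seq; apply: big_ind => [|U V|U]; first exact: openT.
- exact: openI.
- exact: so.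
Qed.

Lemma open_meet2E U V W : open U -> open V ->
  is_meet (opens X) [set U; V] W <-> W = U `&` V.
Proof. by move=> oU oV; apply: is_meet2E; exact: openI. Qed.

(** Strong exactness tested on y = ~` closure [set x], the largest open
avoiding x: U -> y is the largest open W such that W `&` U avoids x, that is y
if x is in U, and everything otherwise. *)
Lemma open_imp_point U x : open U ->
  is_imp (opens X) U (~` closure [set x]) (~` closure [set x]) <-> U x.
Proof.
move=> oU; have oy : open (~` closure [set x]) by rewrite openC; exact: closed_closure.
split=> [[_ _ _ impP]|Ux].
  apply: contrapT => Ux.
  have : ([set: X] <= ~` closure [set x])%O.
    apply/(impP _ openT); exists U.
      by apply/open_meet2E; rewrite ?setTI //; exact: openT.
    rewrite subsetEset => z Uz /closure_set1P zx; apply: Ux; exact: zx.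
  by rewrite subsetEset => /(_ x I); apply; exact/closure_set1P.
split=> // W oW; split=> [Wy|[m /(open_meet2E _ oW oU) ->]].
  exists (W `&` U); first exact/open_meet2E.
  by move: Wy; rewrite !subsetEset; apply: subset_trans; exact: subIsetl.
rewrite !subsetEset => WUy z Wz /closure_set1P zx.
by apply: (WUy x); [split=> //; exact: zx|exact/closure_set1P].
Qed.

(** Only strongly exact meets need an idea: if x belongs to all members of A,
then each of them fixes ~` closure [set x] under implication, hence so does the
strongly exact meet m, so x is in m by open_imp_point. *)
Lemma opens_saturated_raney : is_raney (opens_saturated X).
Proof.
have satU (A : set (set X)) : A `<=` opens X -> A `<=` saturated X.
  by move=> Ao U /Ao; exact: open_saturated.
have oU (A : set (set X)) : A `<=` opens X -> open (\bigcup_(B in A) B).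
  by move=> Ao; apply: bigcup_open => B /Ao.
split=> /=.
- apply: set_family_coframe; first exact: saturated_bigcap.
  move=> a b /saturatedP Sa /saturatedP Sb; apply/saturatedP => x y [ax|bx] xy.
  + by left; exact: Sa xy.
  + by right; exact: Sb xy.
- exact: opens_saturated_sub.
- by apply: set_family_frame; [exact: oU|exact: openI].
- by move=> c [A Ao ->]; exists A => //; exact/saturated_meetE.
- move=> A x Ao /(is_joinE _ (oU _ Ao)) ->.
  by apply/is_joinE => //; apply: saturated_bigcup; exact: satU.
- move=> A x Ao fA /(is_meetE _ (open_finite_bigcap fA Ao)) ->.
  exact/saturated_meetE.
- move=> A m [Ao [[om mA] _] exact_m]; apply/saturated_meetE => //.
  apply/seteqP; split=> [x mx U AU|x Ax].
    by have := mA _ AU; rewrite subsetEset; exact.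
  apply/(open_imp_point _ om)/exact_m.
    by rewrite /opens /= openC; exact: closed_closure.
  by move=> U AU; apply/open_imp_point; [exact: Ao|exact: Ax].
Qed.

End Saturated.

(** * Regular filters of opens *)

Section RegularFilters.
Context {X : topologicalType}.
Implicit Types (x y z : X) (U V W S : set X) (A F R : set (set X)).

Definition polar A : set (set X) :=
  [set U | open U /\ forall V, A V -> U `|` V = setT].

Lemma top_opens : top_set (opens X) = [set setT].
Proof.
apply/seteqP; split=> [U|_ ->].
  by move=> /is_meetE; rewrite bigcap_set0; apply; exact: openT.
by apply/is_meetE; rewrite bigcap_set0 //; exact: openT.
Qed.

Lemma polar_filter A : filters (opens X) (polar A).
Proof.
split.
- by move=> U [].
- by rewrite top_opens => _ ->; split=> [|V _]; [exact: openT|rewrite setTU].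
- move=> U V [_ UA] oV; rewrite subsetEset => UV; split=> // W AW.
  by rewrite -subTset -(UA _ AW); exact: setSU.
- move=> U V W [oU UA] [oV VA] /(open_meet2E _ oU oV) ->; split; first exact: openI.
  by move=> B AB; rewrite setUIl UA // VA // setIT.
Qed.

Lemma filter_setI F R :
  filters (opens X) F -> filters (opens X) R -> filters (opens X) (F `&` R).
Proof.
move=> [Fo FT Fup FI] [Ro RT Rup RI]; split.
- by move=> U [/Fo].
- by move=> U TU; split; [exact: FT|exact: RT].
- by move=> U V [FU RU] oV UV; split; [exact: Fup UV|exact: Rup UV].
- by move=> U V W [FU RU] [FV RV] Wm; split; [exact: FI Wm|exact: RI Wm].
Qed.

Lemma top_filter : filters (opens X) (top_set (opens X)).
Proof.
have -> : top_set (opens X) = polar (opens X); last exact: polar_filter.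
rewrite top_opens; apply/seteqP; split=> [_ ->|U [_ /(_ _ open0)]].
  by split=> [|V _]; [exact: openT|rewrite setTU].
by rewrite setU0.
Qed.

Lemma filter_imp_polar F : filters (opens X) F ->
  is_imp (filters (opens X)) F (top_set (opens X)) (polar F).
Proof.
move=> Ff; split=> //; [exact: top_filter|exact: polar_filter|move=> R Rf].
have RFm m : is_meet (filters (opens X)) [set R; F] m <-> m = R `&` F.
  by apply: is_meet2E; exact: filter_setI.
have [Fo _ Fup _] := Ff; have [Ro _ Rup _] := Rf.
rewrite top_opens; split=> [|[m /RFm ->]]; rewrite !subsetEset => RF.
  exists (R `&` F); first exact/RFm.
  rewrite subsetEset => U [/RF [_ UF] FU].
  by rewrite -(setUid U); exact: UF.
move=> U RU; have oU := Ro _ RU; split=> // V FV.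
have oUV : open (U `|` V) by apply: openU => //; exact: Fo.
apply: RF; split.
- by apply: (Rup U) => //; rewrite subsetEset; exact: subsetUl.
- by apply: (Fup V) => //; rewrite subsetEset; exact: subsetUr.
Qed.

(** The last step of any Galois connection; it exhibits polar A, for A merely a
family of opens, as the pseudocomplement of the filter polar (polar A). *)
Lemma polarK A : A `<=` opens X -> polar (polar (polar A)) = polar A.
Proof.
move=> Ao; apply/seteqP; split=> U [oU UA]; split=> // V.
- move=> AV; apply: UA; split; first exact: Ao.
  by move=> W [_ /(_ _ AV)]; rewrite setUC.
- by move=> [_ /(_ U)]; rewrite setUC; apply.
Qed.

Lemma regular_filtersP R : regular_filters (opens X) R <->
  exists2 A, A `<=` opens X & R = polar A.
Proof.
split=> [[F Ff RF]|[A Ao ->]].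
  have [Fo _ _ _] := Ff; exists F => //.
  exact: is_imp_unique RF (filter_imp_polar Ff).
exists (polar (polar A)); first exact: polar_filter.
by rewrite -[X in is_imp _ _ _ X]polarK //; apply/filter_imp_polar/polar_filter.
Qed.

Lemma regular_filter_open R : regular_filters (opens X) R -> R `<=` opens X.
Proof. by move=> /regular_filtersP[A _ ->] U []. Qed.

(** A point x outside a member V of A is in every member of polar A, hence in
U; so U covers what each V in A misses. *)
Lemma regular_filter_compact R U : regular_filters (opens X) R ->
  open U -> \bigcap_(V in R) V `<=` U -> R U.
Proof.
move=> /regular_filtersP[A Ao ->] oU AU; split=> // V AV.
rewrite -subTset => x _; have [Vx|Vx] := pselect (V x); [by right|left].
by apply: AU => W [_ /(_ _ AV) WV]; have [] : (W `|` V) x by rewrite WV.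
Qed.

Lemma opens_saturated_R_compact : R_compact (opens_saturated X).
Proof.
move=> R U m Rr oU /saturated_meetE mE; rewrite subsetEset mE; last first.
  exact: regular_filter_open.
exact: regular_filter_compact.
Qed.

(** Let x specialize to y, with polar A cutting out the saturation of y. Some V
in A misses y: otherwise all of them contain the closure of y, since a point z
of it other than y is not in the saturation of y, hence is avoided by a member
of polar A and so lies in each V; then ~` closure [set y] would be in polar A,
and y would avoid itself. Now V misses x too, so x is in all of polar A, that is
in the saturation of y, and x = y by T0. *)
Lemma accessible_of_regular_point_filters : kolmogorov_space X ->
    (forall y, exists2 R, regular_filters (opens X) R &
       forall z, (\bigcap_(U in R) U) z <-> specializes y z) ->
  accessible_space X.
Proof.
move=> T0 regX; apply/accessible_spaceP => x y xy.
apply: specializes_anti => //.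
have [_ /regular_filtersP[A Ao ->] yP] := regX y.
have [V AV Vy] : exists2 V, A V & ~ V y.
  apply: contrapT => Ay.
  have AyT V : A V -> V y by move=> AV; apply: contrapT => Vy; apply: Ay; exists V.
  have /yP capy : specializes y y by [].
  have /capy : polar A (~` closure [set y]).
    split; first by rewrite openC; exact: closed_closure.
    move=> V AV; rewrite -subTset => z _.
    have [/closure_set1P zy|] := pselect (closure [set y] z); [right|by left].
    have [yz|yz] := pselect (specializes y z).
      by rewrite -(specializes_anti T0 yz zy); exact: AyT.
    apply: contrapT => Vz; apply/yz/yP => U [_ /(_ _ AV) UV].
    by have [] : (U `|` V) z by rewrite UV.
  by apply; exact/closure_set1P.
apply/yP => U [_ /(_ _ AV) UV].
have [//|Vx] : (U `|` V) x by rewrite UV.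
by case: Vy; apply: xy => //; exact: Ao.
Qed.

(** Joins of saturated sets are unions, so a member b of the family whose join
is the saturation of y contains y, and hence equals that saturation. *)
Lemma R_dense_accessible : kolmogorov_space X ->
  R_dense (opens_saturated X) -> accessible_space X.
Proof.
move=> T0 dense; apply: accessible_of_regular_point_filters => // y.
have [|B BR] := dense [set z | specializes y z].
  by apply/saturatedP => x z /= yx xz U oU /(yx _ oU) /(xz _ oU).
have BS : B `<=` saturated X by move=> b /BR [F _ [[]]].
move=> /(is_joinE _ (saturated_bigcup BS)) yE.
have [b Bb b_y] : (\bigcup_(b in B) b) y by rewrite -yE.
have [R Rr /(saturated_meetE _ (regular_filter_open Rr)) bE] := BR _ Bb.
exists R => // z; rewrite -bE; split=> [bz|yz].
  suff : [set z | specializes y z] z by [].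
  by rewrite yE; exists b.
by have /saturatedP := BS _ Bb; apply; [exact: b_y|].
Qed.

Lemma up_filterP U V :
  up_filter (opens X) U V <-> open V /\ U `<=` V.
Proof. by rewrite /up_filter /= subsetEset. Qed.

Lemma bigcap_up_filter S : saturated X S ->
  \bigcap_(U in up_filter (opens X) S) U = S.
Proof.
move=> [G Go SE]; apply/seteqP; split=> [x xS|x Sx U /up_filterP[_]]; last exact.
rewrite SE => U GU; apply: xS; apply/up_filterP; split; first exact: Go.
by rewrite SE; exact: bigcap_inf.
Qed.

Lemma accessible_up_filter_regular S : accessible_space X ->
  regular_filters (opens X) (up_filter (opens X) S).
Proof.
move=> T1; apply/regular_filtersP; exists [set ~` [set x] | x in S].
  by move=> _ [x _ <-]; rewrite /opens /= openC; exact: accessible_closed_set1.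
apply/seteqP; split=> U.
  move=> /up_filterP[oU SU]; split=> // _ [x /SU Ux <-].
  by rewrite -subTset => z _; have [->|zx] := pselect (z = x); [left|right].
move=> [oU UA]; apply/up_filterP; split=> // x Sx.
have [//|] : (U `|` ~` [set x]) x by rewrite UA //; exists x.
by move=> /(_ erefl).
Qed.

Lemma accessible_saturated S : accessible_space X -> saturated X S.
Proof.
by move=> /accessible_spaceP T1; apply/saturatedP => x y Sx /T1 <-.
Qed.

Lemma saturated_accessible : (forall S, saturated X S) -> accessible_space X.
Proof.
move=> sat; apply/accessible_spaceP => x y xy.
by have /saturatedP/(_ x y erefl xy) -> := sat [set x].
Qed.

Lemma accessible_R_dense : accessible_space X -> R_dense (opens_saturated X).
Proof.
move=> T1 c _; exists [set [set x] | x in c].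
  move=> _ [x _ <-]; exists (up_filter (opens X) [set x]).
    exact: accessible_up_filter_regular.
  apply/saturated_meetE; first by move=> U /up_filterP[].
  by rewrite bigcap_up_filter //; exact: accessible_saturated.
apply/is_joinE; first exact: accessible_saturated.
by rewrite bigcup_image bigcup_imset1 image_id.
Qed.

(** The order on regular filters is reverse inclusion. That R is recovered from
its intersection is regular_filter_compact. *)
Lemma accessible_order_iso : accessible_space X ->
  order_iso (saturated X)
    (regular_filters (opens X) : set ((set (set X))^d)%type)
    (up_filter (opens X)) (fun R => \bigcap_(U in R) U).
Proof.
move=> T1; split.
- by move=> S _; exact: accessible_up_filter_regular.
- by move=> R _; exact: accessible_saturated.
- exact: bigcap_up_filter.
- move=> R Rr; apply/seteqP; split=> U.
    by move=> /up_filterP[oU]; exact: regular_filter_compact.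
  move=> RU; apply/up_filterP; split; first exact: regular_filter_open RU.
  exact: bigcap_inf.
- move=> S S' satS satS'; rewrite leEdual; apply/idP/idP; rewrite !subsetEset.
    by move=> SS'; rewrite -(bigcap_up_filter satS) -(bigcap_up_filter satS');
      move=> x xS U /SS'; exact: xS.
  move=> SS' U /up_filterP[oU S'U]; apply/up_filterP; split=> //.
  exact: subset_trans SS' S'U.
Qed.

(** An order automorphism of the opens preserves and reflects covers by two
opens, the only data from which polars are built. *)
Lemma open_iso_cover (psi : set X -> set X) U V :
    (forall W, open W -> open (psi W)) ->
    (forall W, open W -> exists2 W', open W' & psi W' = W) ->
    (forall W W', open W -> open W' -> psi W `<=` psi W' <-> W `<=` W') ->
  open U -> open V -> (psi U `|` psi V = setT <-> U `|` V = setT).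
Proof.
move=> opsi surj le oU oV.
have psiT : psi setT = setT.
  have [Q oQ QT] := surj _ openT.
  by rewrite -subTset -[X in X `<=` _]QT; apply/le => //; exact: openT.
rewrite -!subTset; split=> UV.
  have oUV := openU oU oV.
  apply/le => //; first exact: openT.
  rewrite psiT; apply: subset_trans UV _; rewrite subUset.
  by split; apply/le.
have [Z oZ ZE] := surj _ (openU (opsi _ oU) (opsi _ oV)).
rewrite -ZE -psiT; apply/le => //; first exact: openT.
apply: subset_trans UV _; rewrite subUset.
by split; apply/le => //; rewrite ZE; [exact: subsetUl|exact: subsetUr].
Qed.

(** For U open, psi U is the open set that the isomorphism matches with the
principal filter of U. A saturated set S sent to polar A satisfies S `<=` psi U
exactly when U is in polar A, so the opens above S form polar (psi @` A). The
first inclusion, part of being a Raney extension, puts the principal filters in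
the domain of g. *)
Lemma raney_isomorphic_accessible : kolmogorov_space X ->
    (regular_filter_pair (opens X)).1 `<=` (regular_filter_pair (opens X)).2 ->
    raney_isomorphic (opens_saturated X) (regular_filter_pair (opens X)) ->
  accessible_space X.
Proof.
move=> T0 upR /raney_isomorphic_order_iso[f [g [/= fg fL gL]]].
have gf := order_iso_sym fg.
pose up := up_filter (opens X); pose psi U := g (up U).
have {}upR U : open U -> regular_filters (opens X) (up U).
  by move=> oU; apply: upR; exists U.
have opsi U : open U -> open (psi U) by move=> oU; apply: gL; exists U.
have psi_surj V : open V -> exists2 U, open U & psi U = V.
  move=> oV; have [U oU UE] := fL _ oV; exists U => //.
  by rewrite /psi /up UE (isoK fg) //; exact: open_saturated.
have psi_le U V : open U -> open V -> psi U `<=` psi V <-> U `<=` V.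
  move=> oU oV; rewrite -subsetEset /psi (iso_le gf); [|exact: upR|exact: upR].
  rewrite leEdual subsetEset; split=> [UV|UV W /up_filterP[oW VW]].
    have /UV/up_filterP[_ //] : up V V.
    by apply/up_filterP; split=> //; exact: subset_refl.
  by apply/up_filterP; split=> //; exact: subset_trans UV VW.
apply: accessible_of_regular_point_filters => // y.
pose S := [set z | specializes y z].
have satS : saturated X S.
  by apply/saturatedP => x z /= yx xz U oU /(yx _ oU) /(xz _ oU).
have /regular_filtersP[A Ao fSE] := iso_fun fg satS.
exists (polar (psi @` A)).
  by apply/regular_filtersP; exists (psi @` A) => // _ [U /Ao oU <-]; exact: opsi.
suff polarE V : polar (psi @` A) V <-> open V /\ V y.
  move=> z; split=> [Az V oV Vy|yz V /polarE[]]; first by apply: Az; apply/polarE.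
  exact: yz.
have psi_polar U : open U -> psi U y <-> polar A U.
  move=> oU; transitivity (S `<=` psi U).
    by split=> [Uy z yz|SU]; [exact: yz (opsi _ oU) Uy|exact: SU].
  rewrite -subsetEset -(iso_le fg) //; last exact/open_saturated/opsi.
  rewrite (iso_invK fg); last exact: upR.
  rewrite leEdual fSE subsetEset; split=> [UA|[_ UA] W /up_filterP[oW UW]].
    by apply: UA; apply/up_filterP; split=> //; exact: subset_refl.
  split=> // B /UA UB; rewrite -subTset -UB; exact: setSU.
have cover U W : open U -> A W -> psi U `|` psi W = setT <-> U `|` W = setT.
  by move=> oU /Ao oW; exact: open_iso_cover.
split=> [[oV]|[oV]]; have [U oU <-] := psi_surj _ oV => UA.
- split; first exact: opsi.
  apply/psi_polar => //; split=> // W AW.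
  by apply/cover => //; apply: UA; exists W.
- have [_ {}UA] := (psi_polar _ oU).1 UA.
  by split=> [|_ [W AW <-]]; [exact: opsi|apply/cover => //; exact: UA].
Qed.

End RegularFilters.

(** * The characterization of accessible spaces *)

Theorem theorem4p12 (X : topologicalType) (hX : kolmogorov_space X) :
  [<-> accessible_space X;
       opens_saturated X = opens_powerset X;
       R_dense (opens_saturated X);
       R_canonical (opens_saturated X);
       is_raney (regular_filter_pair (opens X)) /\
       raney_isomorphic (opens_saturated X) (regular_filter_pair (opens X))].
Proof.
tfae.
- move=> T1; congr pair; apply/seteqP; split=> // S _.
  exact: accessible_saturated.
- move=> [satT]; apply/accessible_R_dense/saturated_accessible => S.
  by rewrite satT.
- by move=> dense; split=> //; exact: opens_saturated_R_compact.
- move=> [/(R_dense_accessible hX) T1 _].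
  have iso := accessible_order_iso T1.
  have LC := @opens_saturated_sub X; pose E := opens_saturated X.
  split; last exact: (@iso_raney_isomorphic _ _ _ _ E _ _ _ iso LC).
  apply: (@iso_raney _ _ _ _ E _ _ _ iso LC).
  exact: opens_saturated_raney.
- by move=> [/raney_sub]; exact: raney_isomorphic_accessible.
Qed.
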